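(* Let $a,b,c,d\ge 2$ be integers, at most one of which equals $2$. Suppose $\gcd(ab,c)=1$, $\gcd(abc,d)=1$, and $\gcd(a,b)\notin\{a,b\}$ (i.e. neither of $a,b$ divides the other). Then $\mathbb{C}[X,Y,Z,T]/(X^a+Y^b+Z^c+T^d)$ is rigid.
   Context: A locally nilpotent derivation (LND) of a $\mathbb{C}$-algebra is a $\mathbb{C}$-linear derivation $D$ such that every element is killed by some power of $D$. A ring is rigid if its only LND is zero. *)

(* Defs.v *)
From HB Require Import structures.
From mathcomp Require Import all_boot all_order all_algebra.
Set Implicit Arguments. Unset Strict Implicit. Unset Printing Implicit Defensive.
Import Order.TTheory GRing.Theory Num.Theory.
Local Open Scope ring_scope.

Definition poly4 (F : fieldType) := {poly {poly {poly {poly F}}}}.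

Definition cst4 (F : fieldType) (c : F) : poly4 F := c%:P%:P%:P%:P.
Definition varX (F : fieldType) : poly4 F := 'X%:P%:P%:P.
Definition varY (F : fieldType) : poly4 F := 'X%:P%:P.
Definition varZ (F : fieldType) : poly4 F := 'X%:P.
Definition varT (F : fieldType) : poly4 F := 'X.

Definition is_quotient_by (F : fieldType) (B : comAlgType F)
  (pi : {rmorphism poly4 F -> B}) (f : poly4 F) : Prop :=
  (forall c : F, pi (cst4 c) = c%:A) /\
  (forall b : B, exists p, pi p = b) /\
  (forall p, pi p = 0 <-> exists q, p = q * f).

Definition is_derivation (F : fieldType) (B : comAlgType F) (D : B -> B) : Prop :=
  (forall x y, D (x + y) = D x + D y) /\
  (forall (c : F) x, D (c *: x) = c *: D x) /\
  (forall x y, D (x * y) = D x * y + x * D y).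

Definition is_LND (F : fieldType) (B : comAlgType F) (D : B -> B) : Prop :=
  is_derivation D /\ (forall x, exists n : nat, iter n D x = 0).

Definition rigid (F : fieldType) (B : comAlgType F) : Prop :=
  forall D : B -> B, is_LND D -> forall x, D x = 0.

(* Main.v *)
Require Import Defs.
From HB Require Import structures.
From mathcomp Require Import all_boot all_order all_algebra.
From mathcomp Require Import zify ring.
Import Order.TTheory GRing.Theory Num.Theory.
Local Open Scope ring_scope.
Set Implicit Arguments. Unset Strict Implicit. Unset Printing Implicit Defensive.

(* Give X, Y, Z, T the weights bcd, acd, abd, abc. By coprimality every
   homogeneous element is T^j times an element of C[X,Y,Z], so B is a domain,
   and the top component of a nonzero locally nilpotent derivation is a nonzero
   homogeneous one, D. Modulo c only Z has nonzero weight, so either Z divides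
   DZ, whence DZ = 0, or Z^(c-1) divides DX, DY and DT; likewise for T and d.
   Let deg be the degree function of D. If DZ and DT are both nonzero, then
   deg Z < deg T < deg Z. So let, say, DT = 0, and put h = X^a + Y^b, of degree
   c deg Z. The Wronskian identity
     X^(a-1) (a DX Y - b X DY) = Y Dh - b DY h
   and its mirror image then bound deg X and deg Y, as in the Mason-Stothers
   theorem, and the bounds force DX = DY = DZ = 0. *)

(** * Arithmetic of the degree bounds *)

(** Here [lx], [ly], [l], [lv] are the degrees of x, y, z and of the Wronskian v. Cancelling [lv]
    against (c-1)l leaves (a-1)lx <= ly + l - 1 and (b-1)ly <= lx + l - 1. If a, b >= 3, the sum
    gives lx + ly + 2 <= 2l, although lx, ly > l(c-1) >= l. If a = 2, then b, c >= 3 and ly + 2 <=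
    2l <= (c-1)l < ly; b = 2 is symmetric. *)
Lemma wronskian_degrees_absurd (a b c lx ly lv l : nat) :
  (2 <= a)%N -> (2 <= b)%N -> (2 <= c)%N ->
  ((a == 2%N) + (b == 2%N) + (c == 2%N) <= 1)%N ->
  (c.-1 * l < lx)%N -> (c.-1 * l < ly)%N -> (c.-1 * l <= lv)%N ->
  (a.-1 * lx + lv <= ly + c * l - 1)%N -> (b.-1 * ly + lv <= lx + c * l - 1)%N ->
  False.
Proof.
move=> a2 b2; case: c => [|[|k]] //= _ abc2 ltx lty le_lv.
rewrite [(k.+2 * l)%N]mulSn => W1 W2.
have le_l : (l <= k.+1 * l)%N by rewrite leq_pmull.
have {}W1 : (a.-1 * lx <= ly + l - 1)%N by move: ltx; lia.
have {}W2 : (b.-1 * ly <= lx + l - 1)%N by move: lty; lia.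
have mul2 p q : (3 <= p)%N -> (2 * q <= p.-1 * q)%N by move=> p3; rewrite leq_mul2r; lia.
have [a3|a3] : (a = 2%N \/ 3 <= a)%N by lia.
  have b3 := mul2 b ly ltac:(lia); have k1 : (2 * l <= k.+1 * l)%N by rewrite leq_mul2r; lia.
  by rewrite a3 mul1n in W1; lia.
have [b3|b3] : (b = 2%N \/ 3 <= b)%N by lia.
  have a3' := mul2 a lx ltac:(lia); have k1 : (2 * l <= k.+1 * l)%N by rewrite leq_mul2r; lia.
  by rewrite b3 mul1n in W2; lia.
by have := mul2 a lx a3; have := mul2 b ly b3; lia.
Qed.

(** * The degree function of a locally nilpotent derivation *)

Section LNDDegree.

Variables (B : comNzRingType) (D : B -> B).
Hypothesis B_domain : forall x y : B, x * y = 0 -> x = 0 \/ y = 0.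
Hypothesis B_char0 : forall (n : nat) (x : B), x *+ n.+1 = 0 -> x = 0.
Hypothesis D_add : forall x y, D (x + y) = D x + D y.
Hypothesis D_mul : forall x y, D (x * y) = D x * y + x * D y.
Hypothesis D_nil : forall x, exists n, iter n D x == 0.

Implicit Types (u v w x y z : B) (m n p q : nat).

Lemma der0 : D 0 = 0.
Proof. by have := D_add 0 0; rewrite addr0 -[X in X = _]addr0 => /addrI. Qed.

Lemma derN x : D (- x) = - D x.
Proof. by apply/eqP; rewrite -addr_eq0 -D_add addNr der0. Qed.

Lemma der1 : D 1 = 0.
Proof. by have := D_mul 1 1; rewrite !mulr1 mul1r -[X in X = _]addr0 => /addrI. Qed.

Lemma der_nat n : D n%:R = 0.
Proof. by elim: n => [|n IH]; rewrite ?der0 // -natr1 D_add IH der1 addr0. Qed.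

Lemma derX x n : D (x ^+ n.+1) = n.+1%:R * x ^+ n * D x.
Proof.
elim: n => [|n IH]; first by rewrite expr1 expr0 !mul1r.
by rewrite exprS D_mul IH -(natr1 n.+1) (exprS x n); ring.
Qed.

Lemma iter_der0 n : iter n D 0 = 0.
Proof. by elim: n => //= n ->; exact: der0. Qed.

Lemma iter_derD n x y : iter n D (x + y) = iter n D x + iter n D y.
Proof. by elim: n => //= n ->; exact: D_add. Qed.

Lemma iter_der_le m n x : (m <= n)%N -> iter m D x = 0 -> iter n D x = 0.
Proof. by move=> le_mn xm; rewrite -(subnK le_mn) iterD xm iter_der0. Qed.

Lemma mulB_neq0 x y : x != 0 -> y != 0 -> x * y != 0.
Proof. by move=> /eqP x0 /eqP y0; apply/eqP => /B_domain []. Qed.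

Lemma expB_neq0 x n : x != 0 -> x ^+ n != 0.
Proof.
move=> x0; elim: n => [|n IH]; first by rewrite expr0 oner_neq0.
by rewrite exprS mulB_neq0.
Qed.

Lemma natB_neq0 n : (n.+1%:R : B) != 0.
Proof. by apply/eqP => /B_char0 /eqP; rewrite oner_eq0. Qed.

(** The largest n with D^n x nonzero, with the convention deg 0 = 0 in place of minus infinity. *)
Definition ldeg x := (ex_minn (D_nil x)).-1.

Lemma ldegP x n : iter n D x != 0 -> iter n.+1 D x = 0 -> ldeg x = n.
Proof.
move=> xn xSn; rewrite /ldeg; case: ex_minnP => m /eqP xm min_m.
suff -> : m = n.+1 by [].
apply/eqP; rewrite eqn_leq min_m ?xSn //= ltnNge.
by apply: contraNN xn => le_mn; apply/eqP; exact: iter_der_le le_mn xm.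
Qed.

Lemma ldeg_iter x : x != 0 -> iter (ldeg x) D x != 0 /\ iter (ldeg x).+1 D x = 0.
Proof.
move=> x0; rewrite /ldeg; case: ex_minnP => -[|m] /eqP xm min_m.
  by move: x0; rewrite -xm eqxx.
by split=> //=; apply/negP => /min_m; rewrite ltnn.
Qed.

(** In the Leibniz expansion of D^(p+q)(xy) only the term D^p x D^q y survives. Peeling off one D
    and using Pascal's rule avoids writing the full sum. *)
Lemma iter_der_mul p q x y : iter p.+1 D x = 0 -> iter q.+1 D y = 0 ->
  iter (p + q) D (x * y) = 'C(p + q, p)%:R * (iter p D x * iter q D y).
Proof.
move: {2}(p + q)%N (erefl (p + q)%N) => n; elim: n p q x y => [|n IH] p q x y.
  by case: p q => [|//] [|//] _ /= _ _; rewrite mul1r.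
case: p => [|p].
  rewrite add0n => -> /= Dx Dy; rewrite bin0 mul1r -!iterS.
  by elim: n.+1 => //= m ->; rewrite D_mul Dx mul0r add0r.
case: q => [|q].
  rewrite addn0 => -> /= Dx Dy; rewrite binn mul1r -!iterS.
  by elim: n.+1 => //= m ->; rewrite D_mul Dy mulr0 addr0.
move=> Epq Dx Dy; rewrite addSn iterSr D_mul iter_derD.
rewrite (IH p q.+1) -?iterSr //; last by lia.
rewrite -addSnnS (IH p.+1 q) -?iterSr //; last by lia.
by rewrite addSn -addnS binS natrD mulrDl addrC -addSnnS.
Qed.

(** The surviving Leibniz term is nonzero because B is a domain of characteristic 0; one further D
    kills it. *)
Lemma ldegM x y : x != 0 -> y != 0 -> ldeg (x * y) = (ldeg x + ldeg y)%N.
Proof.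
move=> /ldeg_iter [x0 x1] /ldeg_iter [y0 y1]; apply: ldegP.
  rewrite iter_der_mul // mulB_neq0 ?mulB_neq0 //.
  by rewrite -(@prednK 'C(_, _)) ?natB_neq0 // bin_gt0 leq_addr.
rewrite iterS iter_der_mul // D_mul der_nat mul0r add0r D_mul.
by move: x1 y1; rewrite !iterS => -> ->; rewrite mul0r !mulr0 addr0 mulr0.
Qed.

Lemma ldegX x n : x != 0 -> ldeg (x ^+ n) = (n * ldeg x)%N.
Proof.
move=> x0; elim: n => [|n IH]; last by rewrite exprS ldegM ?expB_neq0 // IH mulSn.
by rewrite expr0; apply: ldegP; rewrite /= ?oner_neq0 ?der1.
Qed.

Lemma ldeg_der x : D x != 0 -> ldeg x = (ldeg (D x)).+1.
Proof. by move=> /ldeg_iter []; rewrite -!iterSr; exact: ldegP. Qed.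

Lemma ldeg_const x : D x = 0 -> ldeg x = 0%N.
Proof.
have [->|x0 Dx] := eqVneq x 0; last by apply: ldegP.
by rewrite /ldeg; case: ex_minnP => -[//|m] _ /(_ 0%N); rewrite /= eqxx => /(_ isT).
Qed.

Lemma ldegN x : ldeg (- x) = ldeg x.
Proof.
have [->|x0] := eqVneq x 0; first by rewrite oppr0.
have iterN n : iter n D (- x) = - iter n D x by elim: n => //= n ->; exact: derN.
by have [h1 h2] := ldeg_iter x0; apply: ldegP; rewrite iterN ?oppr_eq0 // h2 oppr0.
Qed.

Lemma ldegDr x y : (ldeg x < ldeg y)%N -> ldeg (x + y) = ldeg y.
Proof.
move=> lt_xy.
have y0 : y != 0 by apply/eqP => y0; rewrite y0 (ldeg_const der0) in lt_xy.
have [h1 h2] := ldeg_iter y0.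
have x0 n : (ldeg x < n)%N -> iter n D x = 0.
  have [->|x0] := eqVneq x 0; first by rewrite iter_der0.
  by move=> lt_n; have [_] := ldeg_iter x0; exact: iter_der_le.
by apply: ldegP; rewrite iter_derD x0 ?add0r // ltnW.
Qed.

Lemma ldegD_le x y n : x + y != 0 -> (ldeg x <= n)%N -> (ldeg y <= n)%N -> (ldeg (x + y) <= n)%N.
Proof.
move=> xy0; have iter0 z : (ldeg z <= n)%N -> iter n.+1 D z = 0.
  have [->|z0] := eqVneq z 0; first by rewrite iter_der0.
  by move=> le_n; have [_] := ldeg_iter z0; exact: iter_der_le.
move=> /iter0 xn /iter0 yn; have [h1 h2] := ldeg_iter xy0.
rewrite leqNgt; apply: contraNN h1 => lt_n.
by apply/eqP/(iter_der_le lt_n); rewrite iter_derD xn yn addr0.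
Qed.

(* A vanishing Wronskian makes [u / v] a constant of the fraction field. *)
Lemma ldeg_wronskian u v : u != 0 -> v != 0 -> D u * v = u * D v -> ldeg u = ldeg v.
Proof.
move=> u0 v0 W.
(* Informally, D^n u = (u/v) D^n v since u/v is a constant. The induction step differentiates the
   previous identity, and multiplies by v to bring in the hypothesis [W]. *)
have Wn n : iter n D u * v = u * iter n D v.
  elim: n => [//|n IH]; apply/eqP; rewrite -subr_eq0; apply/eqP.
  have := congr1 D IH; rewrite !D_mul -!iterS => E.
  suff: v * (iter n.+1 D u * v - u * iter n.+1 D v) = 0.
    by move=> /B_domain [] // /eqP; rewrite (negPf v0).
  have -> : iter n.+1 D u * v - u * iter n.+1 D v = D u * iter n D v - iter n D u * D v.
    by apply/eqP; rewrite subr_eq -addrA [X in _ == _ + X]addrC addrA -subr_eq opprK E.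
  have -> : v * (D u * iter n D v - iter n D u * D v)
      = (D u * v) * iter n D v - (iter n D u * v) * D v by ring.
  by rewrite W IH; ring.
have [h1 h2] := ldeg_iter v0; apply: ldegP.
  apply: contraNN (mulB_neq0 u0 h1) => /eqP E.
  by rewrite -Wn E mul0r.
by have := Wn (ldeg v).+1; rewrite h2 mulr0 => /B_domain [] // /eqP; rewrite (negPf v0).
Qed.

(* Otherwise [deg (D z) >= deg z]. *)
Lemma der_dvd_self z : (exists w, D z = z * w) -> D z = 0.
Proof.
move=> [w Dz]; apply/eqP; apply/negPn/negP => Dz0.
have z0 : z != 0 by apply: contraNneq Dz0 => ->; rewrite der0.
have w0 : w != 0 by apply: contraNneq Dz0 => w0; rewrite Dz w0 mulr0.
by have := ldeg_der Dz0; rewrite Dz ldegM //; lia.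
Qed.

Lemma ldeg_dvd z x n : z != 0 -> x != 0 -> (exists w, x = z ^+ n * w) -> (n * ldeg z <= ldeg x)%N.
Proof.
move=> z0 x0 [w xE]; have w0 : w != 0 by apply: contraNneq x0 => w0; rewrite xE w0 mulr0.
by rewrite xE ldegM ?expB_neq0 // ldegX // leq_addr.
Qed.

(** * Mason-Stothers bounds from the Wronskian *)

Lemma wronskian_sum_id x y a b : (0 < a)%N -> (0 < b)%N ->
  x ^+ a.-1 * (a%:R * D x * y - b%:R * x * D y)
    = y * D (x ^+ a + y ^+ b) - b%:R * D y * (x ^+ a + y ^+ b).
Proof. by case: a b => [//|a] [//|b] _ _; rewrite D_add !derX /= !exprS; ring. Qed.

(** Compares degrees in [wronskian_sum_id]: each term on the right contains one D, which lowers its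
    degree to at most deg y + deg h - 1. *)
Lemma wronskian_sum_ldeg x y a b n (h := x ^+ a + y ^+ b)
    (v := a%:R * D x * y - b%:R * x * D y) :
  (0 < a)%N -> (0 < b)%N -> x != 0 -> v != 0 -> (0 < ldeg y)%N ->
  ldeg h = n ->
  (a.-1 * ldeg x + ldeg v <= ldeg y + n - 1)%N.
Proof.
move=> a0 b0 x0 v0 y1 hn.
have E : x ^+ a.-1 * v = y * D h + - (b%:R * D y * h) by exact: wronskian_sum_id.
have Dy0 : D y != 0 by apply: contraTneq y1 => /ldeg_const ->.
have y0 : y != 0 by apply: contraNneq Dy0 => ->; rewrite der0.
have b1 : (b%:R : B) != 0 by case: (b) b0 => // ? _; exact: natB_neq0.
rewrite -ldegX // -ldegM ?expB_neq0 // E.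
apply: ldegD_le; first by rewrite -E mulB_neq0 ?expB_neq0.
  have [->|Dh] := eqVneq (D h) 0; first by rewrite mulr0 (ldeg_const der0).
  by rewrite ldegM // -hn (ldeg_der Dh); lia.
have [->|h0] := eqVneq h 0; first by rewrite mulr0 oppr0 (ldeg_const der0).
by rewrite ldegN !ldegM ?mulB_neq0 // (ldeg_const (der_nat _)) hn (ldeg_der Dy0); lia.
Qed.

(** The case of a derivation killing one of the last two variables. It is stated for arbitrary
    elements so that Z and T can exchange roles. *)
Lemma sum_powers_der0 a b c d x y z t :
  (2 <= a)%N -> (2 <= b)%N -> (2 <= c)%N ->
  ((a == 2%N) + (b == 2%N) + (c == 2%N) <= 1)%N ->
  x != 0 -> y != 0 -> z != 0 -> x ^+ a + y ^+ b != 0 ->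
  x ^+ a + y ^+ b + z ^+ c + t ^+ d = 0 ->
  D t = 0 ->
  D z = 0 \/ (exists u v, D x = z ^+ c.-1 * u /\ D y = z ^+ c.-1 * v) ->
  [/\ D x = 0, D y = 0 & D z = 0].
Proof.
move=> a2 b2 c2 abc2 x0 y0 z0 h0 eq0 Dt Dz.
set h := x ^+ a + y ^+ b in h0 eq0.
set m := ldeg z.
have a0 : (0 < a)%N by lia.
have b0 : (0 < b)%N by lia.
have c0 : (0 < c)%N by lia.
have hE : h = - (t ^+ d + z ^+ c) by apply/eqP; rewrite -addr_eq0 [t ^+ d + _]addrC addrA eq0.
have Dtd : D (t ^+ d) = 0 by case: (d) => [|d']; rewrite ?expr0 ?der1 // derX Dt mulr0.
(* h = -(t^d + z^c) with t^d constant, so z^c alone determines the degree. *)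
have degh : ldeg h = (c * m)%N.
  have [Dz0|Dz0] := eqVneq (D z) 0.
    rewrite /m !ldeg_const ?muln0 //.
    by rewrite hE derN D_add Dtd -(prednK c0) derX Dz0 mulr0 addr0 oppr0.
  have m0 := ldeg_der Dz0; rewrite hE ldegN.
  have lzc : ldeg (z ^+ c) = (c * m)%N by exact: ldegX.
  by rewrite ldegDr // lzc (ldeg_const Dtd) muln_gt0 c0 /m m0.
have dx : D x != 0 -> (c.-1 * m < ldeg x)%N.
  move=> Dx; rewrite (ldeg_der Dx) ltnS; case: Dz => [/ldeg_const|[u [v [Eu _]]]].
    by rewrite -/m => ->; rewrite muln0.
  by apply: ldeg_dvd => //; exists u.
have dy : D y != 0 -> (c.-1 * m < ldeg y)%N.
  move=> Dy; rewrite (ldeg_der Dy) ltnS; case: Dz => [/ldeg_const|[u [v [_ Ev]]]].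
    by rewrite -/m => ->; rewrite muln0.
  by apply: ldeg_dvd => //; exists v.
(* With k = a or b this shows that a nonconstant x or y has a power of degree above deg h = cm.
   Hence the top degrees of x^a and y^b must cancel in h. *)
have mul_gt k n : (2 <= k)%N -> (c.-1 * m < n)%N -> (c * m < k * n)%N.
  move=> k2 lt_n; have m_le : (m <= c.-1 * m)%N by rewrite leq_pmull //; lia.
  by apply: leq_trans (leq_mul k2 lt_n); rewrite -(prednK c0) /= mulSn; lia.
have lxa : ldeg (x ^+ a) = (a * ldeg x)%N by exact: ldegX.
have lyb : ldeg (y ^+ b) = (b * ldeg y)%N by exact: ldegX.
have [Dx|Dx] := eqVneq (D x) 0; have [Dy|Dy] := eqVneq (D y) 0.
(* If x and y are constants, so is h, and cm = 0 contradicts deg z > 0. *)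
- split=> //; apply/eqP; apply/negPn/negP => /ldeg_der; rewrite -/m => m0.
  have: ldeg h = 0%N by rewrite ldeg_const // D_add -(prednK a0) -(prednK b0) !derX Dx Dy !mulr0 addr0.
  by rewrite degh m0; lia.
(* If just one of x, y is a constant, no cancellation is possible in h. *)
- have := mul_gt _ _ b2 (dy Dy); rewrite -degh /h ldegDr ?lyb ?ltnn //.
  by rewrite lxa ldeg_const // muln0 muln_gt0 b0 (leq_trans _ (dy Dy)).
- have := mul_gt _ _ a2 (dx Dx); rewrite -degh /h addrC ldegDr ?lxa ?ltnn //.
  by rewrite lyb [ldeg y]ldeg_const // muln0 muln_gt0 a0 (leq_trans _ (dx Dx)).
have {}dx := dx Dx; have {}dy := dy Dy.
have ax_by : (a * ldeg x = b * ldeg y)%N.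
  case: (ltngtP (a * ldeg x)%N (b * ldeg y)%N) => // lt_xy.
    by have := mul_gt _ _ b2 dy; rewrite -degh /h ldegDr lyb ?ltnn ?lxa.
  by have := mul_gt _ _ a2 dx; rewrite -degh /h addrC ldegDr lxa ?ltnn ?lyb.
pose v := a%:R * D x * y - b%:R * x * D y.
have ID := wronskian_sum_id x y a0 b0.
(* If v = 0, the identity reads y Dh = b Dy h, so h and y^b have zero Wronskian and equal degrees,
   against deg y^b > cm. *)
have [v0|v0] := eqVneq v 0.
  have: ldeg h = ldeg (y ^+ b).
    apply: ldeg_wronskian; rewrite ?expB_neq0 //.
    move: ID; rewrite -/h -/v v0 mulr0 => /esym/eqP; rewrite subr_eq0 => /eqP ID.
    rewrite -(prednK b0) derX prednK // -[in LHS](prednK b0) exprS.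
    by transitivity (y ^+ b.-1 * (y * D h)); [ring | rewrite ID; ring].
  by rewrite degh lyb; have := mul_gt _ _ b2 dy; lia.
have vz : (c.-1 * m <= ldeg v)%N.
  case: Dz => [/ldeg_const|[u [w [Eu Ew]]]]; first by rewrite -/m => ->; rewrite muln0.
  apply: ldeg_dvd => //; exists (a%:R * u * y - b%:R * x * w).
  by rewrite /v Eu Ew; ring.
have y1 : (0 < ldeg y)%N by exact: leq_trans dy.
have x1 : (0 < ldeg x)%N by exact: leq_trans dx.
have W1 := wronskian_sum_ldeg a0 b0 x0 v0 y1 degh.
pose v' := b%:R * D y * x - a%:R * y * D x.
have vN : v' = - v by rewrite /v /v'; ring.
have v'0 : v' != 0 by rewrite vN oppr_eq0.
have degh' : ldeg (y ^+ b + x ^+ a) = (c * m)%N by rewrite addrC.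
have W2 := wronskian_sum_ldeg b0 a0 y0 v'0 x1 degh'.
rewrite -/v' vN ldegN in W2; rewrite -/v in W1.
by case: (wronskian_degrees_absurd a2 b2 c2 abc2 dx dy vz W1 W2).
Qed.

End LNDDegree.

(** * Gradings and divisibility of homogeneous elements *)

Lemma exists_mul_mod (q w : nat) (n : int) : (0 < q)%N -> coprime q w ->
  exists (j : nat) (k : int), (j < q)%N /\ n = j%:Z * w%:Z + q%:Z * k.
Proof.
move=> q0 co_qw; have [u [v E]] := Bezoutz q%:Z w%:Z.
have {}E : u * q%:Z + v * w%:Z = 1.
  by rewrite E /gcdz /=; move: co_qw; rewrite /coprime => /eqP ->.
have q0' : q%:Z != 0 by lia.
(* From uq + vw = 1, v inverts w modulo q, so j is the residue of nv. *)
exists (absz (n * v %% q%:Z)%Z), ((n * v %/ q%:Z)%Z * w%:Z + n * u).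
have r0 := modz_ge0 (n * v) q0'; have rq := ltz_pmod (n * v) (q0 : 0 < q%:Z).
split; first by lia.
have -> : (absz (n * v %% q%:Z)%Z)%:Z = (n * v %% q%:Z)%Z by lia.
rewrite -[LHS]mulr1 -E; transitivity (n * u * q%:Z + (n * v) * w%:Z); first by ring.
by rewrite [in LHS](divz_eq (n * v) q%:Z); ring.
Qed.

(* A grading of [B] by nonnegative weights is encoded by its coaction
   [phi : B -> B[u]], which sends a homogeneous [b] of weight [i] to [b * u^i]. *)
Section Grading.

Variables (F : fieldType) (B : comAlgType F) (phi : {rmorphism B -> {poly B}}).
Variable gens : seq (B * nat).
Hypothesis counit : forall b, (phi b).[1] = b.
Hypothesis coassoc : forall b i, phi (phi b)`_i = (phi b)`_i *: 'X^i.
Hypothesis phi_cst : forall c : F, phi c%:A = (c%:A)%:P.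
Hypothesis phi_gen : forall g, g \in gens -> phi g.1 = g.1 *: 'X^(g.2).
Hypothesis gens_ind : forall P : B -> Prop,
  (forall c : F, P c%:A) -> (forall x y, P x -> P y -> P (x + y)) ->
  (forall g, g \in gens -> forall b, P b -> P (g.1 * b)) -> forall b, P b.

Implicit Types (b x y : B) (n m e i j : int).

(** Weights range over the integers because a homogeneous derivation may lower them; components of
    negative weight are 0. *)
Definition wcomp n b := if n is Posz k then (phi b)`_k else 0.

Definition homog n b := wcomp n b = b.

Lemma wcompD n x y : wcomp n (x + y) = wcomp n x + wcomp n y.
Proof. by case: n => k /=; rewrite ?addr0 // rmorphD coefD. Qed.

Lemma wcomp0 n : wcomp n 0 = 0.
Proof. by case: n => k //=; rewrite rmorph0 coef0. Qed.

Lemma wcomp_sum n M (f : 'I_M -> B) : wcomp n (\sum_(i < M) f i) = \sum_(i < M) wcomp n (f i).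
Proof. by elim/big_rec2: _ => [|k x y _ <-]; rewrite ?wcomp0 ?wcompD. Qed.

Lemma wcompK n m b : wcomp n (wcomp m b) = if n == m then wcomp m b else 0.
Proof.
case: m n => [m|m] [n|n] //=; rewrite ?rmorph0 ?coef0 ?if_same //.
by rewrite coassoc coefZ coefXn eqz_nat; case: eqP => _; rewrite ?mulr1 ?mulr0.
Qed.

Lemma homog_comp n b : homog n (wcomp n b).
Proof. by rewrite /homog wcompK eqxx. Qed.

Lemma homog_Posz (k : nat) b : homog k b <-> phi b = b *: 'X^k.
Proof.
by split=> [<-|E]; rewrite /homog /= ?coassoc // E coefZ coefXn eqxx mulr1.
Qed.

Lemma homog_Negz (k : nat) b : homog (Negz k) b -> b = 0.
Proof. by []. Qed.

Lemma homog_gen g : g \in gens -> homog g.2 g.1.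
Proof. by move=> g_in; apply/homog_Posz; exact: phi_gen. Qed.

Lemma wcomp_cst n (c : F) : wcomp n c%:A = if n == 0 then c%:A else 0.
Proof. by case: n => [[|k]|k] //=; rewrite phi_cst coefC. Qed.

Lemma wcomp_homogM n i x y : homog i x -> wcomp n (x * y) = x * wcomp (n - i) y.
Proof.
case: i => [i|i]; last by move=> /homog_Negz ->; rewrite !mul0r wcomp0.
move=> /homog_Posz xE; case: n => [n|n].
  have [lt_ni|le_in] := ltnP n i.
    have -> : n%:Z - i%:Z = Negz (i - n).-1 by lia.
    by rewrite /= rmorphM xE -scalerAl coefZ coefXnM lt_ni.
  by rewrite subzn //= rmorphM xE -scalerAl coefZ coefXnM ltnNge le_in.
have -> : Negz n - i%:Z = Negz (n + i) by lia.
by rewrite /= mulr0.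
Qed.

Lemma homogM i j x y : homog i x -> homog j y -> homog (i + j) (x * y).
Proof. by move=> hx hy; rewrite /homog (wcomp_homogM _ _ hx) addrC addKr hy. Qed.

Lemma sum_comp M b : (size (phi b) <= M)%N -> b = \sum_(k < M) wcomp k b.
Proof.
move=> le_M; rewrite -{1}[b]counit (horner_coef_wide _ le_M).
by apply: eq_bigr => k _; rewrite expr1n mulr1.
Qed.

Lemma homog_ind (P : B -> Prop) : (forall x y, P x -> P y -> P (x + y)) ->
  (forall n b, homog n b -> P b) -> forall b, P b.
Proof.
move=> PD Ph b; rewrite (sum_comp (leqnn (size (phi b)))).
apply: (big_ind P) => // [|k _]; first exact: (Ph 0 0 (wcomp0 0)).
exact/Ph/homog_comp.
Qed.

Lemma exists_comp_neq0 b : b != 0 -> exists k : nat, wcomp k b != 0.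
Proof.
move=> b0; exists (size (phi b)).-1; rewrite /= -lead_coefE lead_coef_eq0.
by apply: contraNneq b0 => E; rewrite -[b]counit E horner0.
Qed.

(** The leading coefficients of [phi x] and [phi y] are the top components of x and y, and their
    product is a coefficient of [phi (x * y)]. *)
Lemma homog_domain :
  (forall i j x y, homog i x -> homog j y -> x * y = 0 -> x = 0 \/ y = 0) ->
  forall x y, x * y = 0 -> x = 0 \/ y = 0.
Proof.
move=> dom x y xy0; have [->|x0] := eqVneq x 0; first by left.
have [->|y0] := eqVneq y 0; first by right.
have phi0 b : b != 0 -> phi b != 0.
  by apply: contraNneq => E; rewrite -[b]counit E horner0.
have hl b : homog (size (phi b)).-1%:Z (lead_coef (phi b)).
  by apply: (homog_comp (size (phi b)).-1%:Z).
have E : (phi x * phi y)`_(size (phi x) + size (phi y)).-2 = 0.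
  by rewrite -rmorphM xy0 rmorph0 coef0.
have [] := dom _ _ _ _ (hl x) (hl y); first by rewrite mul_lead_coef.
  by move/eqP; rewrite lead_coef_eq0 (negPf (phi0 _ x0)).
by move/eqP; rewrite lead_coef_eq0 (negPf (phi0 _ y0)).
Qed.

(* Every monomial of weight [n] has an exponent of [z] congruent to [j] modulo
   [q]; the part of that exponent beyond [j] is absorbed in [S]. *)
Lemma wcomp_dvd (S : B -> Prop) z (w q : nat) :
  (0 < q)%N -> coprime q w -> (z, w) \in gens ->
  (forall c : F, S c%:A) -> (forall x y, S x -> S y -> S (x + y)) ->
  (forall b, S b -> S (z ^+ q * b)) ->
  (forall g, g \in gens -> g != (z, w) ->
    (q %| g.2)%N /\ forall b, S b -> S (g.1 * b)) ->
  forall b n (j : nat), (j < q)%N -> (exists k : int, n = j%:Z * w%:Z + q%:Z * k) ->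
  exists2 b', S b' & wcomp n b = z ^+ j * b'.
Proof.
move=> q0 co_qw z_in SC SD Sz Sg; elim/gens_ind => [c|x y IHx IHy|g g_in b IH] n j lt_jq nE.
- rewrite wcomp_cst; case: eqP => [n0|_]; last first.
    by exists 0; rewrite ?mulr0 // -(scale0r 1).
  suff -> : j = 0%N by exists c%:A; rewrite ?mul1r.
  case: nE => k; rewrite n0 => E.
  have: (q %| j)%N.
    rewrite -(Gauss_dvdl _ co_qw); have: (q%:Z %| (j * w)%N%:Z)%Z.
      by apply/dvdzP; exists (- k); rewrite PoszM; lia.
    by [].
  by case: j lt_jq {E} => // j lt_jq /dvdn_leq; lia.
- have [x' Sx' Ex] := IHx n j lt_jq nE; have [y' Sy' E] := IHy n j lt_jq nE.
  by exists (x' + y'); [exact: SD | rewrite wcompD Ex E mulrDr].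
have [gz|gz] := eqVneq g (z, w); last first.
  have [/dvdnP [l gE] Sg'] := Sg _ g_in gz; case: nE => k nE.
  have [|b' Sb' E] := IH (n - g.2%:Z) j lt_jq.
    by exists (k - l%:Z); rewrite nE gE PoszM; ring.
  by exists (g.1 * b'); [exact: Sg' | rewrite (wcomp_homogM _ _ (homog_gen g_in)) E mulrCA].
rewrite (wcomp_homogM _ _ (homog_gen g_in)) gz /=.
(* For j = 0 the cofactor of z has residue q - 1, and z * z^(q-1) = z^q goes into S; otherwise the
   residue just drops by one. *)
case: nE; case: j lt_jq => [|j] lt_jq k nE.
  have [||b' Sb' E] := IH (n - w%:Z) q.-1; first by lia.
    exists (k - w%:Z); rewrite nE; have -> : q%:Z = 1 + q.-1%:Z by lia.
    by ring.
  by exists (z ^+ q * b'); [exact: Sz | rewrite E mul1r mulrA -exprS prednK].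
have [||b' Sb' E] := IH (n - w%:Z) j; first by lia.
  by exists k; rewrite nE intS; ring.
by exists b' => //; rewrite E mulrA -exprS.
Qed.

(* A homogeneous element is [t ^+ j * iota p], and a product of two such
   elements times a power of [t] lies in the domain [iota A]. *)
Lemma cyclic_cover_domain (A : idomainType) (iota : {rmorphism A -> B})
    (t : B) (w q : nat) (r : A) :
  (0 < q)%N -> coprime q w -> (t, w) \in gens ->
  (forall c : F, exists p, c%:A = iota p) ->
  (forall g, g \in gens -> g != (t, w) -> (q %| g.2)%N /\ exists p, g.1 = iota p) ->
  t ^+ q = iota r -> r != 0 -> (forall p, iota p = 0 -> p = 0) ->
  forall x y, x * y = 0 -> x = 0 \/ y = 0.
Proof.
move=> q0 co_qw t_in cst_iota gens_iota tq r0 iota_inj.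
apply: homog_domain => i j u v hu hv uv0.
have dvd b n : homog n b -> exists (p : A) (k : nat), (k < q)%N /\ b = t ^+ k * iota p.
  move=> hb; have [k [m [lt_k nE]]] := exists_mul_mod n q0 co_qw.
  have [b' [p ->] E] : exists2 b', (exists p, b' = iota p) & wcomp n b = t ^+ k * b'.
    apply: (wcomp_dvd (w := w) (q := q)) => //.
    - by move=> _ _ [p ->] [p' ->]; exists (p + p'); rewrite rmorphD.
    - by move=> _ [p ->]; exists (r * p); rewrite tq rmorphM.
    - move=> g g_in gt; have [q_g [p' ->]] := gens_iota _ g_in gt; split=> //.
      by move=> _ [p ->]; exists (p' * p); rewrite rmorphM.
    by exists m.
  by exists p, k; rewrite -E hb.
have [p [k [lt_k uE]]] := dvd _ _ hu; have [p' [l [lt_l vE]]] := dvd _ _ hv.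
(* Completing t^k and t^l to t^q turns uv into p p' r^2, an element of the image of [iota]. *)
have : (p * p') * (r * r) = 0.
  apply: iota_inj; rewrite !rmorphM -!tq.
  have tqE (m : nat) : (m < q)%N -> t ^+ q = t ^+ (q - m) * t ^+ m.
    by move=> /ltnW le_m; rewrite -exprD subnK.
  transitivity (t ^+ (q - k) * t ^+ (q - l) * (u * v)); last by rewrite uv0 mulr0.
  by rewrite {1}(tqE k lt_k) (tqE l lt_l) uE vE; ring.
move/eqP; rewrite !mulf_eq0 (negPf r0) !orbF uE vE.
by case/orP => /eqP ->; [left | right]; rewrite rmorph0 mulr0.
Qed.

(** * Top component of a locally nilpotent derivation *)

Section TopComponent.

Variable D : B -> B.
Hypothesis D_add : forall x y, D (x + y) = D x + D y.
Hypothesis D_mul : forall x y, D (x * y) = D x * y + x * D y.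
Hypothesis D_nil : forall x, exists k, iter k D x == 0.
Hypothesis D_cst : forall c : F, D c%:A = 0.

Let D0 : D 0 = 0 := der0 D_add.

(** The part of D that shifts weights by e. *)
Definition der_comp e b := \sum_(k < size (phi b)) wcomp (k%:Z + e) (D (wcomp k b)).

Lemma der_comp_widen e M b : (size (phi b) <= M)%N ->
  der_comp e b = \sum_(k < M) wcomp (k%:Z + e) (D (wcomp k b)).
Proof.
move=> le_M; rewrite /der_comp.
rewrite (big_ord_widen M (fun k : nat => wcomp (k%:Z + e) (D (wcomp k b)))) //.
rewrite big_mkcond; apply: eq_bigr => k _; case: ltnP => // le_k.
by rewrite /= nth_default // D0 wcomp0.
Qed.

Lemma der_compD e x y : der_comp e (x + y) = der_comp e x + der_comp e y.
Proof.
pose M := maxn (size (phi x)) (size (phi y)).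
rewrite !(@der_comp_widen e M) ?leq_maxl ?leq_maxr //; last first.
  by rewrite rmorphD size_polyD.
by rewrite -big_split; apply: eq_bigr => k _; rewrite wcompD D_add wcompD.
Qed.

Lemma der_comp_homog e n b : homog n b -> der_comp e b = wcomp (n + e) (D b).
Proof.
case: n => [n|n] hb; last first.
  by rewrite (homog_Negz hb) D0 wcomp0 /der_comp rmorph0 size_poly0 big_ord0.
have size_b : (size (phi b) <= n.+1)%N.
  by rewrite ((homog_Posz n b).1 hb) (leq_trans (size_scale_leq _ _)) ?size_polyXn.
rewrite (der_comp_widen _ size_b) big_ord_recr /= big1 ?add0r => [|k _].
  by have -> : (phi b)`_n = b by exact: hb.
have -> : (phi b)`_k = wcomp k (wcomp n b) by rewrite hb.
by rewrite wcompK eqz_nat ltn_eqF // D0 wcomp0.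
Qed.

Lemma homog_der_comp e n b : homog n b -> homog (n + e) (der_comp e b).
Proof. by move=> hb; rewrite (der_comp_homog e hb); exact: homog_comp. Qed.

Lemma der_compM e x y : der_comp e (x * y) = der_comp e x * y + x * der_comp e y.
Proof.
elim/homog_ind: x => [x x' IH IH'|i x hx]; first by rewrite !(mulrDl, der_compD) IH IH'; ring.
elim/homog_ind: y => [y y' IH IH'|j y hy]; first by rewrite !(mulrDr, der_compD) IH IH'; ring.
rewrite !(der_comp_homog e (homogM hx hy), der_comp_homog e hx, der_comp_homog e hy).
rewrite D_mul wcompD (wcomp_homogM _ _ hx) [D x * y]mulrC (wcomp_homogM _ _ hy) [y * _]mulrC.
by congr (wcomp _ _ * _ + _ * wcomp _ _); lia.
Qed.

Section Bounded.
Variable e : int.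
Hypothesis e_gens : forall g, g \in gens -> forall n, g.2%:Z + e < n -> wcomp n (D g.1) = 0.

(** By the Leibniz rule, a bound e on the weight shift of D at the generators holds everywhere. *)
Lemma wcomp_der_gt n b j : n + e < j -> wcomp j (D (wcomp n b)) = 0.
Proof.
elim/gens_ind: b n j => [c|x y IHx IHy|g g_in b IH] n j lt_j.
- by rewrite wcomp_cst; case: ifP; rewrite ?D_cst ?D0 wcomp0.
- by rewrite wcompD D_add wcompD IHx // IHy // addr0.
rewrite (wcomp_homogM _ _ (homog_gen g_in)) D_mul wcompD.
rewrite (wcomp_homogM _ _ (homog_gen g_in)) IH ?mulr0 ?addr0; last by lia.
rewrite mulrC (wcomp_homogM _ _ (homog_comp _ _)) (e_gens g_in) ?mulr0 //; lia.
Qed.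

Lemma wcomp_der n b : (forall j, n < j -> wcomp j b = 0) ->
  wcomp (n + e) (D b) = wcomp (n + e) (D (wcomp n b)) /\
  (forall j, n + e < j -> wcomp j (D b) = 0).
Proof.
move=> b_le; have Db j : wcomp j (D b) = \sum_(k < size (phi b)) wcomp j (D (wcomp k b)).
  rewrite {1}(sum_comp (leqnn (size (phi b)))) -wcomp_sum; congr wcomp.
  by elim/big_rec2: _ => [|k x y _ <-]; rewrite ?D0 ?D_add.
split=> [|j lt_j]; rewrite Db; last first.
  apply: big1 => k _; have [le_kn|lt_nk] := lerP k%:Z n; last by rewrite b_le // D0 wcomp0.
  by apply: wcomp_der_gt; lia.
case: n b_le => [n|n] b_le; last first.
  have -> : wcomp (Negz n) b = 0 by [].
  by rewrite D0 wcomp0 big1 // => k _; rewrite b_le ?D0 ?wcomp0.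
have [lt_n|le_n] := ltnP n (size (phi b)).
  rewrite (bigD1 (Ordinal lt_n)) //= big1 ?addr0 // => k neq_k.
  have [le_kn|lt_nk] := leqP k n; last by rewrite [(phi b)`_k](b_le k) // D0 wcomp0.
  apply: (@wcomp_der_gt k); have : (k != n :> nat) by apply: contraNneq neq_k => E; apply/eqP/val_inj.
  by lia.
rewrite [wcomp n b]nth_default // D0 wcomp0 big1 // => k _.
by apply: wcomp_der_gt; have := ltn_ord k; lia.
Qed.

(** As D raises weights by at most e, iterating its degree-e part computes the top component of D^k
    b. Hence that part inherits local nilpotence from D. *)
Lemma iter_der_comp (k : nat) n b : homog n b ->
  iter k (der_comp e) b = wcomp (n + k%:Z * e) (iter k D b) /\
  (forall j, n + k%:Z * e < j -> wcomp j (iter k D b) = 0).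
Proof.
move=> hb; elim: k => [|k [IH1 IH2]].
  rewrite mul0r addr0; split=> [//|j lt_j] /=.
  by rewrite -hb wcompK gt_eqF.
have -> : n + k.+1%:Z * e = n + k%:Z * e + e by rewrite intS; ring.
rewrite !iterS; have [E1 E2] := wcomp_der IH2; split=> //.
by rewrite E1 -IH1 (der_comp_homog _ (n := n + k%:Z * e)) // IH1; exact: homog_comp.
Qed.

Lemma der_comp_nil b : exists k, iter k (der_comp e) b == 0.
Proof.
elim/homog_ind: b => [x y [n /eqP xn] [m /eqP ym]|n b hb]; last first.
  have [k /eqP Dk] := D_nil b; exists k.
  by rewrite (iter_der_comp k hb).1 Dk wcomp0.
exists (maxn n m); rewrite iter_derD; last exact: der_compD.
rewrite (iter_der_le _ (leq_maxl n m) xn) ?(iter_der_le _ (leq_maxr n m) ym) ?addr0 //.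
all: exact: der_compD.
Qed.

End Bounded.

(* [E] is the homogeneous component of [D] of top degree. *)
Lemma exists_homog_LND : (exists2 g, g \in gens & D g.1 != 0) ->
  exists (e : int) (E : B -> B), [/\ forall x y, E (x + y) = E x + E y,
    forall x y, E (x * y) = E x * y + x * E y,
    forall x, exists k, iter k E x == 0,
    forall n b, homog n b -> homog (n + e) (E b) &
    exists2 g, g \in gens & E g.1 != 0].
Proof.
move=> [g0 g0_in Dg0].
(* The shift e may be negative, so it is coded by the natural number k = e + W. Below -W all
   components on generators vanish, and M bounds the weights from above, so a maximal k exists. *)
pose W := \max_(g <- gens) g.2.
have leW g : g \in gens -> (g.2 <= W)%N by move=> g_in; exact: (leq_bigmax_seq (F := snd)).
pose M := \max_(g <- gens) size (phi (D g.1)).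
have leM g : g \in gens -> (size (phi (D g.1)) <= M)%N.
  by move=> g_in; exact: (leq_bigmax_seq (F := fun g => size (phi (D g.1)))).
pose P (k : nat) := has (fun g => wcomp (g.2%:Z + (k%:Z - W%:Z)) (D g.1) != 0) gens.
have exP : exists k, P k.
  have [n Dn] := exists_comp_neq0 Dg0.
  exists (n + (W - g0.2))%N; apply/hasP; exists g0 => //.
  by have -> : g0.2%:Z + ((n + (W - g0.2))%N%:Z - W%:Z) = n by have := leW _ g0_in; lia.
have leP k : P k -> (k <= M + W)%N.
  move=> /hasP [g g_in]; apply: contraNT; rewrite -ltnNge => lt_k.
  have -> : g.2%:Z + (k%:Z - W%:Z) = (g.2 + k - W)%N by lia.
  by rewrite /= nth_default // (leq_trans (leM _ g_in)) //; lia.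
case: (ex_maxnP exP leP) => k /hasP [g g_in Dg] max_k.
pose e := k%:Z - W%:Z.
have e_gens g' : g' \in gens -> forall n, g'.2%:Z + e < n -> wcomp n (D g'.1) = 0.
  move=> g'_in n lt_n; apply/eqP; apply/negPn/negP => Dn.
  have := max_k (absz (n - g'.2%:Z + W%:Z)); have := leW _ g'_in => le_w.
  have E : g'.2%:Z + ((absz (n - g'.2%:Z + W%:Z))%:Z - W%:Z) = n by rewrite /e in lt_n; lia.
  have -> : P (absz (n - g'.2%:Z + W%:Z)) by apply/hasP; exists g' => //; rewrite E.
  by move=> /(_ isT); rewrite /e in lt_n; lia.
exists e, (der_comp e); split.
- exact: der_compD.
- exact: der_compM.
- exact: der_comp_nil.
- by move=> n b; exact: homog_der_comp.
by exists g => //; rewrite (der_comp_homog e (homog_gen g_in)).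
Qed.

End TopComponent.
(** Let w + e = jw modulo q with 0 <= j < q. If j > 0, then z divides E z, which forces E z = 0. If
    j = 0, then e = (q-1)w modulo q, so E sends generators of weight divisible by q to multiples of
    z^(q-1). *)
Lemma homog_der_cases (E : B -> B) e z (w q : nat) :
  (forall x y, x * y = 0 -> x = 0 \/ y = 0) ->
  (forall (k : nat) x, x *+ k.+1 = 0 -> x = 0) ->
  (forall x y, E (x + y) = E x + E y) ->
  (forall x y, E (x * y) = E x * y + x * E y) ->
  (forall x, exists k, iter k E x == 0) ->
  (forall n b, homog n b -> homog (n + e) (E b)) ->
  (0 < q)%N -> coprime q w -> (z, w) \in gens ->
  (forall g, g \in gens -> g != (z, w) -> (q %| g.2)%N) ->
  E z = 0 \/
  forall g, g \in gens -> (q %| g.2)%N -> exists b, E g.1 = z ^+ q.-1 * b.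
Proof.
move=> dom char0 E_add E_mul E_nil E_homog q0 co_qw z_in q_dvd.
have dvd b n (j : nat) : homog n b -> (j < q)%N ->
    (exists k : int, n = j%:Z * w%:Z + q%:Z * k) -> exists b', b = z ^+ j * b'.
  move=> hb lt_jq nE.
  have [b' _ Eb] : exists2 b', True & wcomp n b = z ^+ j * b'.
    apply: (@wcomp_dvd (fun _ => True) z w q) => // g g_in gz.
    by split=> //; exact: q_dvd.
  by exists b'; rewrite -Eb hb.
have hEz := E_homog _ _ (homog_gen z_in).
have [j [k [lt_jq jE]]] := exists_mul_mod (w%:Z + e) q0 co_qw.
case: j lt_jq jE => [|j] lt_jq jE; last first.
  left; apply: (der_dvd_self dom char0 E_add E_mul E_nil).
  have [|b ->] := dvd _ _ _ hEz lt_jq; first by exists k.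
  by exists (z ^+ j * b); rewrite exprS mulrA.
right=> g g_in /dvdnP [l gE]; apply: (dvd _ _ _ (E_homog _ _ (homog_gen g_in))); first by lia.
exists (k + l%:Z - w%:Z); rewrite gE PoszM.
have -> : e = q%:Z * k - w%:Z by move: jE; rewrite mul0r add0r /=; lia.
have -> : q%:Z = 1 + q.-1%:Z by lia.
by ring.
Qed.

End Grading.

(** * Morphisms and induction for the quotient presentation *)

(** Universal property of the quotient: psi is applied to a chosen preimage, and the kernel
    condition makes the choice irrelevant. *)
Lemma quotient_lift (R : nzRingType) (B S : comNzRingType) (pi : {rmorphism R -> B})
    (psi : {rmorphism R -> S}) :
  (forall b, exists p, pi p = b) -> (forall p, pi p = 0 -> psi p = 0) ->
  exists phi : {rmorphism B -> S}, forall p, phi (pi p) = psi p.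
Proof.
move=> pi_surj ker_le.
have exP b : exists p, pi p == b by have [p <-] := pi_surj b; exists p.
pose lift b := xchoose (exP b).
have liftK b : pi (lift b) = b by apply/eqP; exact: (xchooseP (exP b)).
have psiE p p' : pi p = pi p' -> psi p = psi p'.
  move=> E; apply/eqP; rewrite -subr_eq0 -rmorphB ker_le //.
  by rewrite rmorphB E subrr.
pose phi b := psi (lift b).
have phiB : zmod_morphism phi.
  by move=> x y; rewrite /phi -rmorphB; apply: psiE; rewrite rmorphB !liftK.
have phiM : monoid_morphism phi.
  split=> [|x y]; rewrite /phi; first by rewrite -(rmorph1 psi); apply: psiE; rewrite liftK rmorph1.
  by rewrite -rmorphM; apply: psiE; rewrite rmorphM !liftK.
pose phiA := GRing.isZmodMorphism.Build B S phi phiB.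
pose phiR := GRing.isMonoidMorphism.Build B S phi phiM.
pose phi' : {rmorphism B -> S} := HB.pack phi phiA phiR.
by exists phi' => p; apply: psiE; rewrite liftK.
Qed.

Lemma poly4_eval (F : fieldType) (S : comNzRingType) (h : {rmorphism F -> S}) (x y z t : S) :
  exists psi : {rmorphism poly4 F -> S},
    [/\ forall c, psi (cst4 c) = h c, psi (varX F) = x, psi (varY F) = y,
        psi (varZ F) = z & psi (varT F) = t].
Proof.
pose com (R : nzRingType) (k : {rmorphism R -> S}) u : commr_rmorph k u := fun r => mulrC _ _.
pose h1 : {rmorphism {poly F} -> S} := horner_morph (com _ h x).
pose h2 : {rmorphism {poly {poly F}} -> S} := horner_morph (com _ h1 y).
pose h3 : {rmorphism {poly {poly {poly F}}} -> S} := horner_morph (com _ h2 z).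
pose h4 : {rmorphism poly4 F -> S} := horner_morph (com _ h3 t).
have h1C c : h1 c%:P = h c by exact: horner_morphC.
have h2C c : h2 c%:P = h1 c by exact: horner_morphC.
have h3C c : h3 c%:P = h2 c by exact: horner_morphC.
have h4C c : h4 c%:P = h3 c by exact: horner_morphC.
exists h4; split; rewrite ?h4C ?h3C ?h2C.
- by move=> c; rewrite /cst4 h4C h3C h2C h1C.
all: exact: horner_morphX.
Qed.

Lemma poly4_ind (F : fieldType) (P : poly4 F -> Prop) :
  (forall c, P (cst4 c)) -> (forall p q, P p -> P q -> P (p + q)) ->
  (forall p, P p -> P (varX F * p)) -> (forall p, P p -> P (varY F * p)) ->
  (forall p, P p -> P (varZ F * p)) -> (forall p, P p -> P (varT F * p)) ->
  forall p, P p.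
Proof.
move=> PC PD PX PY PZ PT.
have P0 : P 0 by have := PC 0; rewrite /cst4 !polyC0.
have ind (R : nzRingType) (Q : {poly R} -> Prop) : Q 0 ->
    (forall p c, Q p -> Q c%:P -> Q (p * 'X + c%:P)) -> (forall c, Q c%:P) -> forall p, Q p.
  by move=> Q0 QD QC; elim/poly_ind => // p c /QD; apply.
have P1 (c : {poly F}) : P c%:P%:P%:P.
  elim/ind: c => [|c k IH _|k]; [by rewrite !polyC0 | | exact: PC].
  by rewrite !polyCD !polyCM mulrC; apply: PD; [exact: PX | exact: PC].
have P2 (c : {poly {poly F}}) : P c%:P%:P.
  elim/ind: c => [|c k IH _|k]; [by rewrite !polyC0 | | exact: P1].
  by rewrite !polyCD !polyCM mulrC; apply: PD; [exact: PY | exact: P1].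
have P3 (c : {poly {poly {poly F}}}) : P c%:P.
  elim/ind: c => [|c k IH _|k]; [by rewrite !polyC0 | | exact: P2].
  by rewrite !polyCD !polyCM mulrC; apply: PD; [exact: PZ | exact: P2].
elim/ind => // p c Pp _.
by rewrite mulrC; apply: PD; [exact: PT | exact: P3].
Qed.

Lemma rmorph_sum4_pow (R S : nzRingType) (f : {rmorphism R -> S}) (x y z t : R) (a b c d : nat) :
  f (x ^+ a + y ^+ b + z ^+ c + t ^+ d) = f x ^+ a + f y ^+ b + f z ^+ c + f t ^+ d.
Proof. by rewrite !rmorphD !rmorphXn. Qed.

Lemma rmorph_sum2_pow (R S : nzRingType) (f : {rmorphism R -> S}) (x y : R) (a b : nat) :
  f (x ^+ a + y ^+ b) = f x ^+ a + f y ^+ b.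
Proof. by rewrite rmorphD !rmorphXn. Qed.

Lemma polyXnD_neq0 (R : nzRingType) (n : nat) (p : R) : (0 < n)%N -> 'X^n + p%:P != 0.
Proof.
move=> n0; rewrite -size_poly_eq0 size_polyDl size_polyXn //.
by rewrite (leq_ltn_trans (size_polyC_leq1 _)).
Qed.

(** A embeds in A[T]/(T^d - r) because a nonzero multiple of this monic polynomial has degree at
    least d > 0. *)
Lemma cyclic_quotient (A : idomainType) (B : comNzRingType) (pi : {rmorphism {poly A} -> B})
    (r : A) (d : nat) : (1 < d)%N ->
  (forall p, pi p = 0 <-> exists q, p = q * ('X^d - r%:P)) ->
  pi 'X ^+ d = pi r%:P /\ forall p, pi p%:P = 0 -> p = 0.
Proof.
move=> d1 ker; have d0 := ltnW d1; split.
  by apply/eqP; rewrite -subr_eq0 -rmorphXn -rmorphB; apply/eqP/ker; exists 1; rewrite mul1r.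
move=> p /ker [q E].
have szf : size ('X^d - r%:P) = d.+1 by rewrite size_XnsubC.
have f0 : 'X^d - r%:P != 0 by rewrite -size_poly_eq0 szf.
have [q0|q0] := eqVneq q 0.
  by apply/eqP; rewrite -polyC_eq0 E q0 mul0r.
have := size_polyC_leq1 p; rewrite E size_mul // szf addnS /=.
have : (0 < size q)%N by rewrite size_poly_gt0.
by lia.
Qed.

(** * The Pham-Brieskorn algebra *)

Section PhamBrieskorn.

Variables (F : fieldType) (hchar : [pchar F] =i pred0) (a b c d : nat).
Hypotheses (ha : (2 <= a)%N) (hb : (2 <= b)%N) (hc : (2 <= c)%N) (hd : (2 <= d)%N).
Hypothesis h2 : ((a == 2%N) + (b == 2%N) + (c == 2%N) + (d == 2%N) <= 1)%N.
Hypotheses (hgc : coprime (a * b) c) (hgd : coprime (a * b * c) d).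
Variables (B : comAlgType F) (pi : {rmorphism poly4 F -> B}).
Hypothesis hB : is_quotient_by pi
  (varX F ^+ a + varY F ^+ b + varZ F ^+ c + varT F ^+ d).

Let x := pi (varX F).
Let y := pi (varY F).
Let z := pi (varZ F).
Let t := pi (varT F).

Lemma pb_relation : x ^+ a + y ^+ b + z ^+ c + t ^+ d = 0.
Proof.
have [_ [_ ker]] := hB; have E := (ker _).2 (ex_intro _ 1 (esym (mul1r _))).
by rewrite -[RHS]E rmorph_sum4_pow.
Qed.

Lemma pb_char0 (n : nat) (u : B) : u *+ n.+1 = 0 -> u = 0.
Proof.
rewrite -scaler_nat => E; have n0 : (n.+1%:R : F) != 0 by rewrite (pcharf0P F).1.
by rewrite -[u]scale1r -(mulVf n0) -scalerA E scaler0.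
Qed.

Local Notation A := {poly {poly {poly F}}}.
Let base : A := 'X%:P%:P ^+ a + 'X%:P ^+ b + 'X ^+ c.

(** Presents B as the cyclic cover T^d = -[base] of A = F[X,Y,Z]. *)
Lemma pb_eqE : varX F ^+ a + varY F ^+ b + varZ F ^+ c + varT F ^+ d = 'X^d - (- base)%:P.
Proof. by rewrite addrC /base polyCN opprK !polyCD !polyC_exp. Qed.

Let iota : {rmorphism A -> B} := pi \o polyC.

Lemma pb_cyclic : t ^+ d = iota (- base) /\ forall p, iota p = 0 -> p = 0.
Proof.
apply: (cyclic_quotient (pi := pi) hd) => p.
by rewrite -pb_eqE; have [_ [_]] := hB; apply.
Qed.

Lemma base_neq0 : base != 0.
Proof.
have -> : base = 'X^c + ('X%:P ^+ a + 'X ^+ b)%:P by rewrite /base addrC polyCD !polyC_exp.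
by apply: polyXnD_neq0; lia.
Qed.

Let iotaE p : iota p = pi p%:P := erefl.

Lemma pb_gens_iota : [/\ x = iota 'X%:P%:P, y = iota 'X%:P & z = iota 'X].
Proof. by split; rewrite iotaE. Qed.

Lemma pb_cst_iota (k : F) : k%:A = iota k%:P%:P%:P.
Proof. by rewrite iotaE; have [<-] := hB. Qed.

Lemma iota_neq0 (p : A) : p != 0 -> iota p != 0.
Proof. by apply: contraNneq => /(pb_cyclic.2) ->. Qed.

Lemma pb_neq0 : [/\ x != 0, y != 0, z != 0, t != 0 & x ^+ a + y ^+ b != 0].
Proof.
have [xE yE zE] := pb_gens_iota; have [tE _] := pb_cyclic; split.
- by rewrite xE iota_neq0 // !polyC_eq0 polyX_eq0.
- by rewrite yE iota_neq0 // polyC_eq0 polyX_eq0.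
- by rewrite zE iota_neq0 // polyX_eq0.
- apply/eqP => t0; have : iota (- base) != 0 by rewrite iota_neq0 // oppr_eq0 base_neq0.
  by rewrite -tE t0 expr0n; case: (d) hd => //= ? _; rewrite eqxx.
rewrite xE yE -(rmorph_sum2_pow iota) iota_neq0 // addrC.
have := polyXnD_neq0 ('X ^+ a : {poly F}) (ltnW hb).
by rewrite -polyC_eq0 polyCD !polyC_exp.
Qed.

Let gens := [:: (x, b * c * d)%N; (y, a * c * d)%N; (z, a * b * d)%N; (t, a * b * c)%N].

Lemma pb_ind (P : B -> Prop) :
  (forall k : F, P k%:A) -> (forall u v, P u -> P v -> P (u + v)) ->
  (forall g, g \in gens -> forall u, P u -> P (g.1 * u)) -> forall u, P u.
Proof.
have [cstE [surj _]] := hB => PC PD PG u; have [p <-] := surj u.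
elim/poly4_ind: p => [k|p q Pp Pq|p Pp|p Pp|p Pp|p Pp].
- by rewrite cstE.
- by rewrite rmorphD; exact: PD.
- by rewrite rmorphM; apply: (PG (x, b * c * d)%N); rewrite // !inE eqxx.
- by rewrite rmorphM; apply: (PG (y, a * c * d)%N); rewrite // !inE eqxx ?orbT.
- by rewrite rmorphM; apply: (PG (z, a * b * d)%N); rewrite // !inE eqxx ?orbT.
- by rewrite rmorphM; apply: (PG (t, a * b * c)%N); rewrite // !inE eqxx ?orbT.
Qed.

(** The substitution X -> x u^(bcd) and its analogues multiply all four summands of the equation by
    u^(abcd), so it descends to B. The axioms are then checked on generators. *)
Lemma pb_coaction : exists phi : {rmorphism B -> {poly B}},
  [/\ forall u, (phi u).[1] = u,
      forall u (i : nat), phi (phi u)`_i = (phi u)`_i *: 'X^i,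
      forall k : F, phi k%:A = (k%:A)%:P &
      forall g, g \in gens -> phi g.1 = g.1 *: 'X^(g.2)].
Proof.
have [cstE [surj ker]] := hB.
pose h : {rmorphism F -> {poly B}} := polyC \o in_alg B.
have [psi [psiC psiX psiY psiZ psiT]] := poly4_eval h
  (x *: 'X^(b * c * d)) (y *: 'X^(a * c * d)) (z *: 'X^(a * b * d)) (t *: 'X^(a * b * c)).
have [p /ker [q ->]|phi phiE] := quotient_lift (psi := psi) surj.
  rewrite [LHS]rmorphM rmorph_sum4_pow psiX psiY psiZ psiT !exprZn -!exprM.
  have -> : (b * c * d * a = a * b * c * d)%N by ring.
  have -> : (a * c * d * b = a * b * c * d)%N by ring.
  have -> : (a * b * d * c = a * b * c * d)%N by ring.
  by rewrite -!scalerDl pb_relation scale0r mulr0.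
have phi_gen g : g \in gens -> phi g.1 = g.1 *: 'X^(g.2).
  by rewrite !inE => /or4P [] /eqP -> /=; rewrite [LHS]phiE ?psiX ?psiY ?psiZ ?psiT.
have phi_cst (k : F) : phi k%:A = (k%:A)%:P by rewrite -[in LHS]cstE phiE psiC.
exists phi; split=> //.
- elim/pb_ind => [k|u v IHu IHv|g g_in u IH].
  + by rewrite phi_cst hornerC.
  + by rewrite rmorphD hornerD IHu IHv.
  + by rewrite rmorphM hornerM phi_gen // IH hornerZ hornerXn expr1n mulr1.
elim/pb_ind => [k|u v IHu IHv|g g_in u IH] i.
- rewrite phi_cst coefC; case: eqP => [->|_]; first by rewrite phi_cst expr0 alg_polyC.
  by rewrite rmorph0 scale0r.
- by rewrite rmorphD coefD rmorphD IHu IHv scalerDl.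
rewrite rmorphM phi_gen // -scalerAl coefZ coefXnM; case: ltnP => [_|le_i].
  by rewrite mulr0 rmorph0 scale0r.
by rewrite rmorphM IH phi_gen // -scalerAl -scalerAr scalerA -exprD subnKC.
Qed.

(** The conditions needed to apply [homog_der_cases] to z modulo c and to t modulo d. *)
Lemma pb_weights :
  [/\ coprime c (a * b * d), coprime d (a * b * c),
      forall g, g \in gens -> g != (z, a * b * d)%N -> (c %| g.2)%N &
      forall g, g \in gens -> g != (t, a * b * c)%N -> (d %| g.2)%N].
Proof.
have co_cd : coprime c d by move: hgd; rewrite coprimeMl => /andP [].
split.
- by rewrite coprimeMr co_cd andbT coprime_sym.
- by rewrite coprime_sym.
- move=> g; rewrite !inE => /or4P [] /eqP -> //=; last by rewrite dvdn_mull.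
  + by rewrite -mulnA dvdn_mull ?dvdn_mulr.
  + by rewrite -mulnA dvdn_mull ?dvdn_mulr.
  + by rewrite eqxx.
- move=> g; rewrite !inE => /or4P [] /eqP -> //=; try by rewrite dvdn_mull.
  by rewrite eqxx.
Qed.

Lemma pb_domain (u v : B) : u * v = 0 -> u = 0 \/ v = 0.
Proof.
have [phi [counit coassoc phiC phi_gen]] := pb_coaction.
have [_ co_d _ dvd_d] := pb_weights.
have [xE yE zE] := pb_gens_iota; have [tE iota_inj] := pb_cyclic.
apply: (cyclic_cover_domain counit coassoc phiC phi_gen pb_ind _ co_d _ _ _ tE _ iota_inj).
- exact: ltnW.
- by rewrite !inE eqxx !orbT.
- by move=> k; exists k%:P%:P%:P; exact: pb_cst_iota.
- move=> g g_in gt; split; first exact: dvd_d.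
  move: g_in gt; rewrite !inE => /or4P [] /eqP -> //=.
  + by eexists; exact: xE.
  + by eexists; exact: yE.
  + by eexists; exact: zE.
  + by rewrite eqxx.
by rewrite oppr_eq0 base_neq0.
Qed.

Lemma pb_rigid : rigid B.
Proof.
move=> D [[D_add [D_scale D_mul]] D_nil].
have [phi [counit coassoc phiC phi_gen]] := pb_coaction.
have D_cst (k : F) : D k%:A = 0 by rewrite D_scale (der1 D_mul) scaler0.
have {}D_nil u : exists k, iter k D u == 0 by have [k E] := D_nil u; exists k; apply/eqP.
(* A derivation vanishing on the generators is 0; otherwise D has a nonzero top component E. *)
have [/hasP [g g_in Dg]|/hasPn Dgens] := boolP (has (fun g => D g.1 != 0) gens); last first.
  elim/pb_ind => [k|u v Du Dv|g /Dgens/negPn/eqP Dg u Du]; first exact: D_cst.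
    by rewrite D_add Du Dv addr0.
  by rewrite D_mul Dg Du mul0r mulr0 addr0.
have [e [E [E_add E_mul E_nil E_homog [g' g'_in Eg']]]] :=
  exists_homog_LND counit coassoc phiC phi_gen pb_ind D_add D_mul D_nil D_cst (ex_intro2 _ _ g g_in Dg).
have [co_c co_d dvd_c dvd_d] := pb_weights.
have [x_in y_in z_in t_in] : [/\ (x, b * c * d)%N \in gens, (y, a * c * d)%N \in gens,
    (z, a * b * d)%N \in gens & (t, a * b * c)%N \in gens].
  by rewrite !inE !eqxx !orbT.
have dom := pb_domain; have [x0 y0 z0 t0 h0] := pb_neq0.
have char0 := pb_char0.
have c0 : (0 < c)%N by exact: ltnW.
have d0 : (0 < d)%N by exact: ltnW.
have Ez := homog_der_cases coassoc phiC phi_gen pb_ind dom char0 E_add E_mul E_nil E_homog c0 co_c z_in dvd_c.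
have Et := homog_der_cases coassoc phiC phi_gen pb_ind dom char0 E_add E_mul E_nil E_homog d0 co_d t_in dvd_d.
have cx : (c %| b * c * d)%N by rewrite -mulnA dvdn_mull ?dvdn_mulr.
have cy : (c %| a * c * d)%N by rewrite -mulnA dvdn_mull ?dvdn_mulr.
have habc : ((a == 2%N) + (b == 2%N) + (c == 2%N) <= 1)%N by apply: leq_trans h2; exact: leq_addr.
have habd : ((a == 2%N) + (b == 2%N) + (d == 2%N) <= 1)%N.
  by apply: leq_trans h2; rewrite leq_add2r leq_addr.
(* E is nonzero on some generator, so killing all four is a contradiction. *)
suff [Ex Ey Ez' Et'] : [/\ E x = 0, E y = 0, E z = 0 & E t = 0].
  by move: g'_in Eg'; rewrite !inE => /or4P [] /eqP -> /=; rewrite ?Ex ?Ey ?Ez' ?Et' eqxx.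
have [Et0|Et0] := eqVneq (E t) 0.
  have [|Ex Ey Ez'] := sum_powers_der0 dom char0 E_add E_mul E_nil ha hb hc habc x0 y0 z0 h0 pb_relation Et0.
  - case: Ez => [->|Ez]; [by left | right].
    have [u Eu] := Ez _ x_in cx; have [v Ev] := Ez _ y_in cy.
    by exists u, v.
  - by split.
(* The same argument with (z, c) and (t, d) exchanged. *)
have [Ez0|Ez0] := eqVneq (E z) 0.
  have rel : x ^+ a + y ^+ b + t ^+ d + z ^+ c = 0 by rewrite -[RHS]pb_relation addrAC.
  have [|Ex Ey Et'] := sum_powers_der0 dom char0 E_add E_mul E_nil ha hb hd habd x0 y0 t0 h0 rel Ez0.
  - case: Et => [->|Et]; [by left | right].
    have [u Eu] := Et _ x_in (dvdn_mull _ (dvdnn d)); have [v Ev] := Et _ y_in (dvdn_mull _ (dvdnn d)).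
    by exists u, v.
  - by split.
case: Ez => [Ez|/(_ _ t_in (dvdn_mull _ (dvdnn c))) t_dvd]; first by rewrite Ez eqxx in Ez0.
case: Et => [Et|/(_ _ z_in (dvdn_mull _ (dvdnn d))) z_dvd]; first by rewrite Et eqxx in Et0.
(* If neither is killed, z^(c-1) divides E t and t^(d-1) divides E z. As D-degree drops by one under
   E, this gives deg z < deg t < deg z. *)
have deg n u v : (2 <= n)%N -> u != 0 -> E v != 0 -> (exists w, E v = u ^+ n.-1 * w) ->
    (ldeg E_nil u < ldeg E_nil v)%N.
  move=> n2 u0 Ev0 /(ldeg_dvd dom char0 E_add E_mul E_nil u0 Ev0) le_uv.
  rewrite (ldeg_der E_add E_nil Ev0) ltnS (leq_trans _ le_uv) // leq_pmull //.
  by case: n n2 {le_uv} => [|[]].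
by have := ltn_trans (deg _ _ _ hc z0 Et0 t_dvd) (deg _ _ _ hd t0 Ez0 z_dvd); rewrite ltnn.
Qed.

End PhamBrieskorn.

Theorem theorem7p14
  (F : closedFieldType) (hchar : [pchar F] =i pred0)
  (a b c d : nat)
  (ha : (2 <= a)%N) (hb : (2 <= b)%N) (hc : (2 <= c)%N) (hd : (2 <= d)%N)
  (h2 : ((a == 2%N) + (b == 2%N) + (c == 2%N) + (d == 2%N) <= 1)%N)
  (hgc : gcdn (a * b) c = 1%N) (hgd : gcdn (a * b * c) d = 1%N)
  (hab : gcdn a b != a) (hba : gcdn a b != b)
  (B : comAlgType F) (pi : {rmorphism poly4 F -> B})
  (hB : is_quotient_by pi
          (varX F ^+ a + varY F ^+ b + varZ F ^+ c + varT F ^+ d)) :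
  rigid B.
Proof.
apply: (@pb_rigid F hchar a b c d ha hb hc hd h2 _ _ B pi hB); exact/eqP.
Qed.
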